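(* Let $T$ be a homogeneous tree, let $1<p<\infty$, $p^*=p/(p-1)$, $0<s<1$, and let $\pi(\alpha)=|\alpha|^{\frac{1-p^*s}{1-p^*}}$ for $\alpha\in E$. Let $\mu$ be a positive Borel measure on $\overline{T}$. Then each of the following two conditions is equivalent to the Hardy inequality, i.e. to the existence of a finite constant $[\mu]$ such that $$\int_{\overline{T}}\Big(\sum_{\alpha\in[o^*,x]}\varphi(\alpha)\Big)^pd\mu(x)\le[\mu]\sum_{\alpha\in E}\varphi(\alpha)^p\pi(\alpha)\qquad\text{for all }\varphi:E\to[0,\infty):$$ (i) $\displaystyle\sup_{\alpha\in E}\frac{1}{\mu(S(\alpha))}\int_{\partial S(\alpha)}\Big(\sum_{x\subset\beta\subseteq\alpha}\frac{\mu(S(\beta))}{|\beta|^s}\Big)^{p^*}dx<\infty;$ (ii) $\displaystyle\sup_{\alpha\in E}\frac{1}{\mu(S(\alpha))}\int_{\partial S(\alpha)}\Big(\sup_{x\subset\beta\subseteq\alpha}\frac{\mu(S(\beta))}{|\beta|^s}\Big)^{p^*}dx<\infty.$ Here the inner sum and supremum run over all edges $\beta\subseteq\alpha$ with $\beta\in[o^*,x]$.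
   Context: Tree setting. $T$ is the infinite rooted homogeneous tree in which every vertex has $q+1$ neighbours, for some fixed integer $q\ge2$; $E$ is its set of edges. One of the neighbours of the root $o$ is an auxiliary pre-root vertex $o^*$, joined to $o$ by the root edge $\omega\in E$ and to no other vertex (so every vertex other than $o^*$ has $q$ children). $T$ also denotes the set of vertices other than $o^*$. $[o^*,x]$ is the set of edges of the geodesic from $o^*$ to the vertex $x$. $\partial T$ is the set of infinite geodesics starting at $o^*$, and for $x\in\partial T$, $[o^*,x]$ is the set of edges of $x$. Put $\overline{T}=T\cup\partial T$, $S(\alpha)=\{x\in\overline{T}:\alpha\in[o^*,x]\}$ and $\partial S(\alpha)=S(\alpha)\cap\partial T$ for $\alpha\in E$. $\overline{T}$ carries the (compact) topology generated by the sets $S(\alpha)$ and the singletons $\{x\}$, $x\in T$; positive Borel measures on $\overline{T}$ are finite. $e(\beta)$ is the endpoint of $\beta$ farthest from $o^*$; $\beta\subseteq\alpha$ means $\alpha\in[o^*,e(\beta)]$; $\beta\supset x$ means $\beta\in[o^*,x]$. For an edge $\alpha$, $|\alpha|=q^{-d(\alpha)}$, where $d(\alpha)$ is the distance between $\alpha$ and $\omega$ ($d(\omega)=0$, and $d$ increases by one passing from an edge to a child edge). $dx$ is the Borel measure on $\partial T$ with $\int_{\partial S(\alpha)}dx=|\alpha|$ for all $\alpha\in E$. A quotient $0/0$ is interpreted as $0$. *)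

(* Defs.v *)
From HB Require Import structures.
From mathcomp Require Import all_boot all_order all_algebra.
From mathcomp Require Import all_classical all_reals all_analysis.

Set Implicit Arguments.
Unset Strict Implicit.
Unset Printing Implicit Defensive.

Import Order.TTheory GRing.Theory Num.Theory.

Local Open Scope classical_set_scope.
Local Open Scope ring_scope.

(* Labels of the q children of a vertex. For q > 0 this is 'I_q; the form
   q.-1.+1 only serves to keep the boundary inhabited for every q, as required
   by the pointed structure underlying measurable types. *)
Definition child (q : nat) : Type := 'I_q.-1.+1.
HB.instance Definition _ (q : nat) := Finite.copy (child q) 'I_q.-1.+1.

(* The vertices other than the pre-root o^*: the word [:: c_1; ...; c_n] is the
   vertex reached from the root o = [::] by following the children c_1, ...,
   c_n. Together with o^*, joined to o only, every vertex but o^* has q + 1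
   neighbours. *)
Definition vertex (q : nat) : Type := seq (child q).
HB.instance Definition _ (q : nat) := Countable.copy (vertex q) (seq (child q)).

(* An edge joins a vertex v <> o^* to its parent (o^* if v = o), and is encoded
   by the word of v. The root edge omega is [::]; the children of the edge b are
   the edges rcons b c. *)
Definition edge (q : nat) : Type := seq (child q).
HB.instance Definition _ (q : nat) := Countable.copy (edge q) (seq (child q)).

(* e(b), the endpoint of b farthest from o^*. *)
Definition far_end (q : nat) (b : edge q) : vertex q := b.

(* An infinite geodesic o^*, o, v_1, v_2, ... is given by the sequence of
   children it follows from o on. *)
Definition boundary (q : nat) : Type := nat -> child q.
HB.instance Definition _ (q : nat) := gen_eqMixin (boundary q).
HB.instance Definition _ (q : nat) := gen_choiceMixin (boundary q).
HB.instance Definition _ (q : nat) := isPointed.Build (boundary q) (fun=> ord0).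

Inductive Tbar (q : nat) : Type :=
  | Vtx of vertex q
  | End of boundary q.
HB.instance Definition _ (q : nat) := gen_eqMixin (Tbar q).
HB.instance Definition _ (q : nat) := gen_choiceMixin (Tbar q).
HB.instance Definition _ (q : nat) := isPointed.Build (Tbar q) (Vtx [::]).

(* [o^*, x], the set of edges of the geodesic from o^* to x. *)
Definition geod (q : nat) (x : Tbar q) : set (edge q) :=
  match x with
  | Vtx v => [set a | prefix a v]
  | End g => [set a | a = mkseq g (size a)]
  end.

(* S(a) and its boundary part; the boundary is a type of its own, embedded in
   Tbar by End. *)
Definition shadow (q : nat) (a : edge q) : set (Tbar q) := [set x | geod x a].

Definition bd_shadow (q : nat) (a : edge q) : set (boundary q) :=
  @End q @^-1` shadow a.

(* b \subseteq a *)
Definition subedge (q : nat) (b a : edge q) : Prop := geod (Vtx (far_end b)) a.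

HB.instance Definition _ (q : nat) := @isSubBaseTopological.Build (Tbar q)
  (set (Tbar q))
  ([set shadow a | a in [set: edge q]] `|`
   [set [set Vtx v] | v in [set: vertex q]])
  id.

HB.instance Definition _ (q : nat) :=
  Topological.copy (boundary q) (initial_topology (@End q)).

Definition borel (X : ptopologicalType) : Type :=
  g_sigma_algebraType (@open X).
HB.instance Definition _ (X : ptopologicalType) := Measurable.on (borel X).

Section hardy.
Context {R : realType} {q : nat}.
Implicit Types (a b : edge q) (p s : R).

(* |a| = q^{-d(a)}: the edge encoded by a word of length n is at distance n from
   the root edge. *)
Definition edge_size a : R := (q%:R : R) ^- size a.

Definition conj_exp p : R := p / (p - 1).

Definition hardy_weight p s a : R :=
  edge_size a `^ ((1 - conj_exp p * s) / (1 - conj_exp p)).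

Variable mu : {finite_measure set (borel (Tbar q)) -> \bar R}.

Local Open Scope ereal_scope.

Definition hardy_inequality p (w : edge q -> R) : Prop :=
  exists C : R, forall phi : edge q -> R, (forall a, (0 <= phi a)%R) ->
    \int[mu]_x ((\esum_(a in geod x) (phi a)%:E) `^ p)
      <= C%:E * \esum_(a in [set: edge q]) (phi a `^ p * w a)%:E.

Variable dx : {measure set (borel (boundary q)) -> \bar R}.

(* In \bar R, 0^-1 = +oo and +oo * 0 = 0, so that the quotients by mu (shadow a)
   obey the convention 0 / 0 = 0. *)
Definition sum_condition p s : Prop :=
  ereal_sup [set (mu (shadow a))^-1 *
    \int[dx]_(x in bd_shadow a)
      (\esum_(b in [set b | subedge b a /\ geod (End x) b])
        (mu (shadow b) / (edge_size b `^ s)%:E)) `^ conj_exp p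
    | a in [set: edge q]] < +oo.

Definition sup_condition p s : Prop :=
  ereal_sup [set (mu (shadow a))^-1 *
    \int[dx]_(x in bd_shadow a)
      (ereal_sup [set mu (shadow b) / (edge_size b `^ s)%:E
        | b in [set b | subedge b a /\ geod (End x) b]]) `^ conj_exp p
    | a in [set: edge q]] < +oo.

End hardy.

(* Main.v *)
Require Import Defs.
From HB Require Import structures.
From mathcomp Require Import all_boot all_order all_algebra.
From mathcomp Require Import all_classical all_reals all_analysis.
From mathcomp Require Import measurable_realfun.
From mathcomp Require Import ring lra.

(** Write [M b] for the mass of the shadow of [b], [l b] for the size of [b],
[r] for the conjugate exponent of [p] and [w b = M b ^ r * pi b ^ (1 - r)],
which equals [l b * (M b / l b ^ s) ^ r]. The pivot of the proof is the testing
(Carleson) condition: the sum of [w b] over the edges [b] below [a] is at most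
[C * M a], uniformly in [a]. The proof goes round the cycle
  sum condition -> sup condition -> Carleson -> Hardy -> Carleson -> sum condition.

One device serves throughout. A function on edges is summed along the geodesic
from the root to a point ([pathsum]), and the integral of such a path sum is the
sum of the function against the masses of the shadows ([integral_pathsum]). Any
function [G] on edges is the path sum of its increments, so in particular the
power [H ^ p] of a path sum [H] has an integral that can be computed on the
edges, and its increment at [a] is at most [p * phi a * H a ^ (p - 1)] by
convexity. Exchanging two sums moves increments from [H] to the tails of the
other factor ([abel_summation]).

Carleson -> Hardy ([carleson_trace]): the integral [X] of [H ^ p] is at most
[p] times the sum of [phi * H ^ (p - 1) * M]; Young's inequality splits this
into a multiple of the sum of [phi ^ p * pi] and a small multiple of the sum of
[w * H ^ p]. By Abel summation and the Carleson condition the latter is at most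
[C * X], and is absorbed.

Hardy -> Carleson ([carleson_of_hardy]): test the inequality on
[phi = M ^ (r - 1) * pi ^ (1 - r)] restricted to the edges below [a].

Sum condition -> sup condition is pointwise. The two remaining implications rest
on an inequality of Wolff type ([wolff]): the [r]-th power of the sum of
[f = M / l ^ s] along a boundary geodesic has an integral controlled by that of
the [r]-th power of its maximum. It holds because the averages of [f] over the
descendants of an edge decay geometrically, as the masses of the children of an
edge add up to at most its own mass and [s < 1]:
so the tail of the sum below [b] averages to at most a constant times [f b]. Abel
summation turns this into a bound by the integral of [H ^ (r - 1)] times the
maximum of [f], and Young's inequality concludes, as in the Garsia-Neveu
inequality for increasing processes. Finally, pointwise, the [l^r] norm along a
geodesic, whose [r]-th power integrates to the sum of [w], lies between the
maximum and the sum.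

All of this is done on finitely many levels of the tree, where every sum is
finite and absorption is legitimate, with constants that do not depend on the
number of levels; monotone convergence ([integral_esum_power_le]) gives the
infinite tree. *)

Set Implicit Arguments.
Unset Strict Implicit.
Unset Printing Implicit Defensive.

Import Order.TTheory GRing.Theory Num.Theory.

Local Open Scope classical_set_scope.
Local Open Scope ring_scope.

(** * Sums along paths in a tree of words *)

Section path_sums.
Context {R : realType} {T : finType}.
Implicit Types (f G w : seq T -> R) (a b t : seq T) (N : nat).

Definition pathsum f t : R := \sum_(k < (size t).+1) f (take k t).

(** The root has no parent, and the increment there is [G] itself: thus [G] is
recovered as a path sum with no condition on its value at the root. *)
Definition incr G a : R :=
  G a - (if size a is n.+1 then G (take n a) else 0).

Lemma pathsum_nil f : pathsum f [::] = f [::].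
Proof. by rewrite /pathsum big_ord1. Qed.

Lemma pathsum_rcons f t c :
  pathsum f (rcons t c) = pathsum f t + f (rcons t c).
Proof.
rewrite /pathsum size_rcons big_ord_recr /=; congr (_ + f _).
  apply: eq_bigr => k _; congr f.
  by rewrite -cats1 takel_cat// -ltnS ltn_ord.
by rewrite take_oversize// size_rcons.
Qed.

Lemma incr_rcons G t c : incr G (rcons t c) = G (rcons t c) - G t.
Proof.
by rewrite /incr size_rcons -cats1 takel_cat// take_size.
Qed.

Lemma incr_nil G : incr G [::] = G [::].
Proof. by rewrite /incr subr0. Qed.

Lemma pathsum_incr G t : pathsum (incr G) t = G t.
Proof.
elim/last_ind: t => [|t c IH]; first by rewrite pathsum_nil incr_nil.
by rewrite pathsum_rcons IH incr_rcons addrC subrK.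
Qed.

Lemma prefix_rconsE a t c :
  prefix a (rcons t c) = (a == rcons t c) || prefix a t.
Proof.
rewrite !prefixE; have [le|gt] := leqP (size a) (size t).
  rewrite -cats1 takel_cat//; case: (a =P t ++ [:: c]) => // ea.
  by move: le; rewrite ea size_cat /= addn1 ltnn.
rewrite take_oversize ?size_rcons// (take_oversize (ltnW gt)) eq_sym.
by case: (t =P a) gt => [->|]; rewrite ?ltnn ?orbF.
Qed.

(** The words of length at most [N] form a finite type, over which sums can be
exchanged; path sums are brought back to that type. *)
Lemma sum_prefix N f t : (size t <= N)%N ->
  \sum_(a : N.-bseq T | prefix a t) f a = pathsum f t.
Proof.
elim/last_ind: t => [|t c IH] tN.
  by rewrite pathsum_nil (big_pred1 (Bseq tN)).
rewrite (bigD1 (Bseq tN)) /=; last exact: prefix_refl.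
rewrite pathsum_rcons addrC; congr (_ + _).
rewrite -IH; last by rewrite (leq_trans _ tN)// size_rcons.
apply: eq_bigl => a; rewrite -(inj_eq val_inj) /= prefix_rconsE.
case: (val a =P rcons t c) => [->|]//=; last by rewrite andbT.
by apply/esym/negP => /size_prefix; rewrite size_rcons ltnn.
Qed.

(** Write [G a] as the sum of its increments at the prefixes of [a], and exchange
the two sums. *)
Lemma abel_summation N w G :
  \sum_(a : N.-bseq T) w a * G a =
  \sum_(b : N.-bseq T) incr G b * \sum_(a : N.-bseq T | prefix b a) w a.
Proof.
transitivity (\sum_(a : N.-bseq T) \sum_(b : N.-bseq T | prefix b a)
    (w a * incr G b)).
  apply: eq_bigr => a _.
  by rewrite -big_distrr /= (sum_prefix (incr G)) ?size_bseq// pathsum_incr.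
rewrite (exchange_big_dep xpredT)//=.
by apply: eq_bigr => b _; rewrite big_distrr /=; apply: eq_bigr => a _; rewrite mulrC.
Qed.

Lemma pathsum_ge0 f t : (forall a, 0 <= f a) -> 0 <= pathsum f t.
Proof. by move=> f0; apply: sumr_ge0. Qed.

Lemma pathsum_prefix f a t : (forall a, 0 <= f a) -> prefix a t ->
  pathsum f a <= pathsum f t.
Proof.
move=> f0; elim/last_ind: t => [|t c IH].
  by rewrite prefixs0 => /eqP ->.
rewrite prefix_rconsE => /orP[/eqP->//|/IH le].
by rewrite pathsum_rcons (le_trans le)// lerDl.
Qed.

Lemma pathsum_ge f a t : (forall a, 0 <= f a) -> prefix a t -> f a <= pathsum f t.
Proof.
move=> f0 /(pathsum_prefix f0); apply: le_trans.
elim/last_ind: a => [|a c _]; first by rewrite pathsum_nil.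
by rewrite pathsum_rcons lerDr pathsum_ge0.
Qed.

Lemma pathsum_eq0 f t : (forall a, prefix a t -> f a = 0) -> pathsum f t = 0.
Proof.
by move=> f0; apply: big1 => k _; apply: f0; exact: prefix_take.
Qed.

Lemma sum_uniq_prefix (f : seq T -> R) t (s : seq (seq T)) :
  (forall a, 0 <= f a) -> uniq s -> {in s, forall a, prefix a t} ->
  \sum_(a <- s) f a <= pathsum f t.
Proof.
move=> f0; elim/last_ind: t s => [|t c IH] s us st.
  rewrite pathsum_nil; have [i|/negbTE ni] := boolP ([::] \in s).
    rewrite (big_rem [::])//= big_seq big1 ?addr0// => a.
    rewrite mem_rem_uniq// inE => /andP[a0 /st]; rewrite prefixs0.
    by rewrite (negbTE a0).
  rewrite big_seq big1 ?f0// => a sa; have := st _ sa.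
  by rewrite prefixs0 => /eqP a0; rewrite -a0 sa in ni.
rewrite pathsum_rcons.
have [i|/negbTE ni] := boolP (rcons t c \in s).
  rewrite (big_rem (rcons t c))//= addrC lerD2r IH ?rem_uniq// => a.
  rewrite mem_rem_uniq// inE => /andP[/negbTE a0 /st].
  by rewrite prefix_rconsE a0.
rewrite -[leLHS]addr0 lerD// IH// => a sa; move: (st _ sa).
by rewrite prefix_rconsE => /orP[/eqP ea|//]; move: ni; rewrite -ea sa.
Qed.

(** For a function [F] of a path sum, the increment at [a] is the difference of
[F] between the sums with and without the last term [f a]; at the root this
needs [F 0 = 0]. *)
Lemma pathsum_last f a : exists2 h, pathsum f a = h + f a &
  (forall F : R -> R, F 0 = 0 -> incr (F \o pathsum f) a = F (h + f a) - F h) /\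
  ((forall b, 0 <= f b) -> 0 <= h).
Proof.
elim/last_ind: a => [|a c _].
  by exists 0; rewrite ?pathsum_nil ?add0r//; split=> // F F0;
    rewrite incr_nil /= pathsum_nil F0 subr0.
exists (pathsum f a); first by rewrite pathsum_rcons.
split=> [F F0|]; first by rewrite incr_rcons /= pathsum_rcons.
exact: pathsum_ge0.
Qed.

End path_sums.

(** * Convexity inequalities for real powers *)

Section young.
Context {R : realType}.
Implicit Types p r x y e : R.

Lemma conjugate_subM p r : 1 < p -> p^-1 + r^-1 = 1 -> (p - 1) * r = p.
Proof.
move=> p1 pr; have p0 : p != 0 by rewrite gt_eqF// (lt_trans ltr01).
have r0 : r != 0.
  apply/eqP => r0; move: pr; rewrite r0 invr0 addr0 => /(congr1 GRing.inv).
  by rewrite invrK invr1 => p1'; rewrite p1' ltxx in p1.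
have : p * r * (p^-1 + r^-1) = p * r by rewrite pr mulr1.
have -> : p * r * (p^-1 + r^-1) = r + p by field; rewrite p0 r0.
by move=> h; rewrite mulrBl mul1r -h addrC addKr.
Qed.

Lemma conjugate_gt1 p r : 1 < p -> p^-1 + r^-1 = 1 -> 1 < r.
Proof.
move=> p1 pr; have := conjugate_subM p1 pr => h.
have p10 : 0 < p - 1 by rewrite subr_gt0.
rewrite -(ltr_pM2l p10) h mulr1; lra.
Qed.

(** Young's inequality with the second term as small as desired: this is what
lets a multiple of the left-hand side of an estimate be absorbed. *)
Lemma young_eps p r e : 1 < p -> p^-1 + r^-1 = 1 -> 0 < e ->
  exists2 K, 0 <= K & forall x y, 0 <= x -> 0 <= y ->
    x * y <= K * x `^ p + e * y `^ r.
Proof.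
move=> p1 pr e0; have r1 := conjugate_gt1 p1 pr.
have p0 : 0 < p by apply: lt_trans p1.
have r0 : 0 < r by apply: lt_trans r1.
(* Young's inequality for [x / d] and [d * y], where [d ^ r = e] *)
pose d := e `^ r^-1; have d0 : 0 < d by rewrite powR_gt0.
exists (d^-1 `^ p) => [|x y x0 y0]; first exact: powR_ge0.
have dx0 : 0 <= d^-1 * x by rewrite mulr_ge0// invr_ge0 ltW.
have dy0 : 0 <= d * y by rewrite mulr_ge0// ltW.
have := conjugate_powR dx0 dy0 p0 r0 pr.
rewrite mulrACA mulVf ?gt_eqF// mul1r => /le_trans; apply.
have dr : d `^ r = e by rewrite /d -powRrM mulVf ?gt_eqF// powRr1// ltW.
rewrite !powRM ?invr_ge0 ?(ltW d0)// dr.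
apply: lerD; rewrite ler_piMr ?mulr_ge0 ?powR_ge0 ?(ltW e0)//.
  by rewrite invf_le1// ltW.
by rewrite invf_le1// ltW.
Qed.

(** Convexity of [x ^ p], read off Young's inequality for [y * x ^ (p - 1)]. *)
Lemma powR_increment_le p x y : 1 < p -> 0 <= y -> y <= x ->
  x `^ p - y `^ p <= p * (x - y) * x `^ (p - 1).
Proof.
move=> p1 y0 yx; have p0 : 0 < p by apply: lt_trans p1.
have x0 : 0 <= x by apply: le_trans yx.
pose r := p / (p - 1).
have p10 : 0 < p - 1 by rewrite subr_gt0.
have r0 : 0 < r by rewrite divr_gt0.
have pr : p^-1 + r^-1 = 1.
  by rewrite /r; field; rewrite !gt_eqF.
have := conjugate_powR y0 (powR_ge0 x (p - 1)) p0 r0 pr.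
rewrite -powRrM (conjugate_subM p1 pr).
rewrite -(ler_pM2l p0) mulrDr.
have -> : p * (y `^ p / p) = y `^ p by field; rewrite gt_eqF.
have -> : p * (x `^ p / r) = (p - 1) * x `^ p.
  by rewrite /r; field; rewrite !gt_eqF.
rewrite -(mulr_powRB1 x0 p0) => h.
rewrite -subr_ge0; move: h; rewrite -subr_ge0 => /le_trans; apply.
by rewrite le_eqVlt; apply/orP; left; apply/eqP; ring.
Qed.

End young.

(** * Inequalities on finitely many levels *)

Section finite_inequalities.
Context {R : realType} {T : finType}.
Implicit Types (f m w l phi pi : seq T -> R) (a b t : seq T) (N : nat).

Lemma powR_monotone (p x y : R) : 0 < p -> 0 <= x -> x <= y -> x `^ p <= y `^ p.
Proof.
move=> p0 x0 xy; apply: ge0_ler_powR => //; rewrite ?nnegrE ?(ltW p0)//.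
exact: le_trans xy.
Qed.

Lemma incr_powR_ge0 f (p : R) a : 0 < p -> (forall b, 0 <= f b) ->
  0 <= incr (fun t => pathsum f t `^ p) a.
Proof.
move=> p0 f0; have [h _ [E h0]] := pathsum_last f a.
rewrite (E (fun x => x `^ p)); last by rewrite powR0 ?gt_eqF.
by rewrite subr_ge0 powR_monotone ?h0// lerDl.
Qed.

Lemma incr_powR_eq0 f (p : R) a : 0 < p -> f a = 0 ->
  incr (fun t => pathsum f t `^ p) a = 0.
Proof.
move=> p0 fa; have [h _ [E h0]] := pathsum_last f a.
rewrite (E (fun x => x `^ p)); last by rewrite powR0 ?gt_eqF.
by rewrite fa addr0 subrr.
Qed.

Lemma incr_powR_le f (p : R) a : 1 < p -> (forall b, 0 <= f b) ->
  incr (fun t => pathsum f t `^ p) a <= p * f a * pathsum f a `^ (p - 1).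
Proof.
move=> p1 f0; have p0 : 0 < p by apply: lt_trans p1.
have [h Hh [E h0]] := pathsum_last f a.
rewrite (E (fun x => x `^ p)); last by rewrite powR0 ?gt_eqF.
rewrite Hh -[X in p * X * _](addKr h) [- h + _]addrC.
by rewrite powR_increment_le ?h0 ?lerDl.
Qed.

(** In each term [f ^ p = f * f ^ (p - 1)], the second factor is at most the
same power of the whole sum. *)
Lemma pathsum_powR_le f (p : R) t : 1 < p -> (forall b, 0 <= f b) ->
  pathsum (fun a => f a `^ p) t <= pathsum f t `^ p.
Proof.
move=> p1 f0; have p0 : 0 < p by apply: lt_trans p1.
have p10 : 0 < p - 1 by rewrite subr_gt0.
rewrite -(mulr_powRB1 (pathsum_ge0 t f0) p0) {2}/pathsum mulr_suml.
apply: ler_sum => k _; rewrite -(mulr_powRB1 (f0 _) p0) ler_wpM2l//.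
by rewrite powR_monotone// pathsum_ge// prefix_take.
Qed.

(** With [X] the left-hand side and [H = pathsum phi], convexity and Young bound
[X] by the target plus a small multiple of the sum of [m ^ r * pi ^ (1 - r) *
H ^ p], which is at most [C * X] by Abel summation and the Carleson hypothesis.
Since [X] is a finite sum it can be absorbed, and [K] is independent of [N]. *)
Lemma carleson_trace (p r C : R) : 1 < p -> p^-1 + r^-1 = 1 -> 0 <= C ->
  exists2 K, 0 <= K & forall N m pi phi,
    (forall a, 0 <= m a) -> (forall a, 0 < pi a) -> (forall a, 0 <= phi a) ->
    (forall b, \sum_(a : N.-bseq T | prefix b a)
       m a `^ r * pi a `^ (1 - r) <= C * m b) ->
    \sum_(a : N.-bseq T) incr (fun t => pathsum phi t `^ p) a * m a <=
    K * \sum_(a : N.-bseq T) phi a `^ p * pi a.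
Proof.
move=> p1 pr C0; have p0 : 0 < p by apply: lt_trans p1.
have r1 := conjugate_gt1 p1 pr; have r0 : 0 < r by apply: lt_trans r1.
have pr1 : r * (p - 1) = p by rewrite mulrC (conjugate_subM p1 pr).
(* the part of [X] to be absorbed is at most [p * e * C * X <= X / 2] *)
pose e := (2 * (C + 1) * p)^-1.
have C1 : 0 < C + 1 by rewrite ltr_wpDl.
have e0 : 0 < e by rewrite invr_gt0 !mulr_gt0.
have [K K0 young] := young_eps p1 pr e0.
exists (2 * p * K); first by rewrite !mulr_ge0// ltW.
move=> N m pi phi m0 pi0 phi0 carl.
set X := leLHS; set Y := \sum_(a : N.-bseq T) phi a `^ p * pi a.
pose w a := m a `^ r * pi a `^ (1 - r).
pose Z := \sum_(a : N.-bseq T) w a * pathsum phi a `^ p.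
have ZX : Z <= C * X.
  rewrite /Z (abel_summation N w (fun t => pathsum phi t `^ p)) /X mulr_sumr.
  apply: ler_sum => b _; rewrite mulrCA.
  by apply: ler_wpM2l; [exact: incr_powR_ge0|exact: carl].
have XZ : X <= p * K * Y + p * e * Z.
  rewrite /X /Y /Z 2!mulr_sumr -big_split /=; apply: ler_sum => a _.
  apply: le_trans (ler_wpM2r (m0 _) (incr_powR_le _ p1 phi0)) _.
  rewrite -!mulrA -mulrDr; apply: ler_wpM2l; first exact: ltW.
  have := young (phi a * pi a `^ p^-1)
    (pathsum phi a `^ (p - 1) * m a * pi a `^ (- p^-1)).
  have H0 := pathsum_ge0 a phi0.
  move=> /(_ (mulr_ge0 (phi0 _) (powR_ge0 _ _))).
  move=> /(_ (mulr_ge0 (mulr_ge0 (powR_ge0 _ _) (m0 _)) (powR_ge0 _ _))).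
  have pi1 : pi a `^ p^-1 * pi a `^ (- p^-1) = 1.
    by rewrite powRN divff// gt_eqF// powR_gt0.
  have -> : phi a * pi a `^ p^-1 *
     (pathsum phi a `^ (p - 1) * m a * pi a `^ (- p^-1)) =
     phi a * (pathsum phi a `^ (p - 1) * m a) *
       (pi a `^ p^-1 * pi a `^ (- p^-1)) by ring.
  rewrite pi1 mulr1 => /le_trans; apply.
  rewrite !powRM ?mulr_ge0 ?powR_ge0// -!powRrM.
  rewrite mulVf ?gt_eqF// (powRr1 (ltW (pi0 _))).
  have -> : - p^-1 * r = 1 - r.
    have -> : p^-1 = 1 - r^-1 by rewrite -pr addrK.
    by field; rewrite gt_eqF.
  rewrite [(p - 1) * r]mulrC pr1 /w.
  by rewrite le_eqVlt; apply/orP; left; apply/eqP; ring.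
have X0 : 0 <= X by apply: sumr_ge0 => a _; rewrite mulr_ge0// incr_powR_ge0.
have peZ : p * e * Z <= 2^-1 * X.
  have -> : p * e = (2 * (C + 1))^-1.
    by rewrite /e; field; rewrite !gt_eqF.
  rewrite invfM -mulrA ler_pM2l ?invr_gt0// mulrC ler_pdivrMr//.
  by rewrite (le_trans ZX)// mulrC ler_wpM2l// lerDl.
rewrite -!mulrA; rewrite -!mulrA in XZ; lra.
Qed.

(** Convexity produces the terms [l * f * H ^ (r - 1)] with [H = pathsum f].
Abel summation then replaces [H ^ (r - 1)] by its increments and [l * f] by its
tail sums, which the hypothesis compares with a single term. The hypothesis is
only asked where [f] is nonzero because elsewhere the increment vanishes. *)
Lemma power_sum_by_potential N l f (r D : R) : 1 < r ->
  (forall a, 0 <= l a) -> (forall a, 0 <= f a) ->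
  (forall b, f b != 0 ->
    \sum_(a : N.-bseq T | prefix b a) l a * f a <= D * (l b * f b)) ->
  \sum_(a : N.-bseq T) incr (fun t => pathsum f t `^ r) a * l a <=
  r * D * \sum_(b : N.-bseq T)
    incr (fun t => pathsum f t `^ (r - 1)) b * f b * l b.
Proof.
move=> r1 l0 f0 pot; have r0 : 0 < r by apply: lt_trans r1.
have r10 : 0 < r - 1 by rewrite subr_gt0.
apply: (@le_trans _ _ (r * \sum_(a : N.-bseq T)
    (l a * f a) * pathsum f a `^ (r - 1))).
  rewrite mulr_sumr; apply: ler_sum => a _.
  apply: le_trans (ler_wpM2r (l0 _) (incr_powR_le _ r1 f0)) _.
  by rewrite le_eqVlt; apply/orP; left; apply/eqP; ring.
rewrite -mulrA ler_pM2l//.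
rewrite (abel_summation N (fun a => l a * f a)
  (fun t => pathsum f t `^ (r - 1))) mulr_sumr.
apply: ler_sum => b _; have [fb|fb] := eqVneq (f b) 0.
  by rewrite incr_powR_eq0// !mul0r mulr0.
rewrite -mulrA mulrCA; apply: ler_wpM2l; first exact: incr_powR_ge0.
by rewrite [f b * _]mulrC; exact: pot.
Qed.

Definition pathmax f t : R := \big[Num.max/0]_(k < (size t).+1) f (take k t).

Lemma pathmax_ge f a t : prefix a t -> f a <= pathmax f t.
Proof.
move=> at_; have ka : (size a < (size t).+1)%N by rewrite ltnS size_prefix.
move: (at_); rewrite prefixE => /eqP {1}<-.
exact: (le_bigmax 0 (fun k : 'I__ => f (take k t)) (Ordinal ka)).
Qed.

Lemma pathmax_ge0 f t : 0 <= pathmax f t.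
Proof. exact: bigmax_ge_id. Qed.

Lemma pathmax_powR_le f t (r : R) : 0 < r -> (forall a, 0 <= f a) ->
  pathmax f t `^ r <= pathsum (fun a => f a `^ r) t.
Proof.
move=> r0 f0; rewrite /pathmax; elim/big_ind: _ => [|x y hx hy|k _].
- by rewrite powR0 ?gt_eqF// pathsum_ge0// => a; exact: powR_ge0.
- by rewrite maxEle; case: ifP.
- apply: (pathsum_ge (f := fun a => f a `^ r)) (prefix_take _ _) => b.
  exact: powR_ge0.
Qed.

(** The increments of [H ^ r] are nonnegative and add up to [H ^ r], so [f] may
be replaced by its maximum along the path. *)
Lemma pathsum_incr_mul_le f (r : R) t : 0 < r -> (forall a, 0 <= f a) ->
  pathsum (fun b => incr (fun t => pathsum f t `^ r) b * f b) t <=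
  pathsum f t `^ r * pathmax f t.
Proof.
move=> r0 f0; rewrite -(pathsum_incr (fun t => pathsum f t `^ r) t).
rewrite {3}/pathsum mulr_suml; apply: ler_sum => k _.
rewrite ler_wpM2l ?incr_powR_ge0//.
by apply: pathmax_ge; exact: prefix_take.
Qed.

(** The stronger bound with [rho ^ (size t).+1] subtracted from the numerator is
the exact value of the sum, and is what the induction on [t] carries. *)
Lemma pathsum_geometric (rho : R) b t : 0 < rho -> rho < 1 ->
  pathsum (fun a => if prefix b a then rho ^+ size a else 0) t <=
  (if prefix b t then rho ^+ size b / (1 - rho) else 0).
Proof.
move=> rho0 rho1; have rho10 : 0 < 1 - rho by rewrite subr_gt0.
apply: (@le_trans _ _ (if prefix b t then
   (rho ^+ size b - rho ^+ (size t).+1) / (1 - rho) else 0)); last first.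
  case: ifP => // _; rewrite ler_wpM2r ?invr_ge0 ?(ltW rho10)//.
  by rewrite gerBl exprn_ge0// ltW.
elim/last_ind: t => [|t c IH].
  rewrite pathsum_nil; case: ifP => //.
  rewrite prefixs0 => /eqP -> /=; rewrite expr0 expr1 divff ?gt_eqF//.
rewrite pathsum_rcons prefix_rconsE.
case: eqVneq IH => [->|neq] IH /=.
  move: IH; case: ifP => [/size_prefix|_ IH].
    by rewrite size_rcons ltnn.
  rewrite [in leRHS]exprS -{2}(mul1r (rho ^+ _)) -mulrBl mulrAC divff ?gt_eqF//.
  by rewrite mul1r gerDr.
case: ifP IH => [_ IH|_ IH]; last by rewrite addr0.
rewrite size_rcons; apply: le_trans (lerD IH (lexx _)) _.
by rewrite le_eqVlt; apply/orP; left; apply/eqP; rewrite !exprS; field;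
  rewrite gt_eqF.
Qed.

End finite_inequalities.

(** * Integrals of path sums *)

Section integral_mono.
Local Open Scope ereal_scope.

(** The integral of a nonnegative function is a supremum over the simple
functions below it, hence monotone without any measurability. This dispenses
with proving that infinite path sums and suprema are measurable. *)
Lemma ge0_le_integral_nonmeasurable d (T : measurableType d) (R : realType)
    (mu : {measure set T -> \bar R}) (D : set T) (f g : T -> \bar R) :
  (forall x, D x -> 0 <= f x) -> (forall x, D x -> f x <= g x) ->
  \int[mu]_(x in D) f x <= \int[mu]_(x in D) g x.
Proof.
move=> f0 fg; rewrite integral_mkcond [leRHS]integral_mkcond.
have f0' x : 0 <= (f \_ D) x.
  by rewrite patchE; case: ifPn => // /set_mem; exact: f0.
have fg' x : (f \_ D) x <= (g \_ D) x.
  by rewrite !patchE; case: ifPn => // /set_mem; exact: fg.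
rewrite !ge0_integralTE//; last by move=> x; exact: le_trans (f0' x) (fg' x).
apply: le_ereal_sup => _ [h hf <-]; exists h => // x.
exact: le_trans (hf x) (fg' x).
Qed.

End integral_mono.

Section truncation.
Context {q : nat}.
Implicit Types (a b : edge q) (x : Tbar q) (N : nat).

(** The last edge of level at most [N] on the geodesic to [x], or the root
edge if [x] is the root: all edges of level at most [N] on that geodesic are its
prefixes. *)
Definition trunc N x : edge q :=
  match x with Vtx v => take N v | End g => mkseq g N end.

Lemma size_trunc N x : (size (trunc N x) <= N)%N.
Proof.
by case: x => [v|g] /=; rewrite ?size_mkseq// size_take_min geq_minl.
Qed.

Lemma geod_trunc N x a : (size a <= N)%N ->
  geod x a <-> prefix a (trunc N x).
Proof.
case: x => [v|g] aN /=; first by rewrite !prefixE take_takel.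
rewrite prefixE /mkseq -map_take take_iota (minn_idPl aN).
by split=> [{2}->|/eqP->].
Qed.

Lemma trunc_geod N x a : prefix a (trunc N x) -> geod x a.
Proof.
move=> ax; apply/(geod_trunc x (N := N)) => //.
exact: leq_trans (size_prefix ax) (size_trunc _ _).
Qed.

Lemma prefix_trunc N N' x : (N <= N')%N -> prefix (trunc N x) (trunc N' x).
Proof.
move=> NN'; apply/geod_trunc; last exact: trunc_geod (prefix_refl _).
exact: leq_trans (size_trunc _ _) NN'.
Qed.

Lemma open_shadow a : open (shadow a).
Proof.
exists [set shadow a]; last by rewrite bigcup_set1.
move=> _ ->; apply: finI_from1; left; exists a => //.
Qed.

Lemma measurable_shadow a : measurable (shadow a : set (borel (Tbar q))).
Proof. by apply: sub_sigma_algebra; exact: open_shadow. Qed.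

Lemma measurable_bd_shadow a :
  measurable (bd_shadow a : set (borel (boundary q))).
Proof.
by apply: sub_sigma_algebra; exists (shadow a) => //; exact: open_shadow.
Qed.

End truncation.

Section finite_esum.
Context {R : realType} {T : finType}.
Local Open Scope ereal_scope.

Lemma subset_esum (I : choiceType) (A B : set I) (f : I -> \bar R) :
  A `<=` B -> \esum_(i in A) f i <= \esum_(i in B) f i.
Proof.
move=> AB; apply: le_ereal_sup => _ [F [finF FA] <-]; exists F => //.
by split=> //; exact: subset_trans AB.
Qed.

Lemma esum_bseq N (P : pred (seq T)) (f : seq T -> R) :
  (forall a, 0 <= f a)%R ->
  \esum_(a in [set a | (size a <= N)%N && P a]) (f a)%:E =
  (\sum_(a : N.-bseq T | P a) f a)%:E.
Proof.
move=> f0; pose s := [seq val a | a <- enum {: N.-bseq T} & P (val a)].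
have us : uniq s.
  by rewrite (map_inj_uniq val_inj) filter_uniq// enum_uniq.
have -> : [set a | (size a <= N)%N && P a] = [set` s].
  apply/seteqP; split=> [a /andP[aN Pa]|a /mapP[b]].
    by apply/mapP; exists (Bseq aN) => //; rewrite mem_filter mem_enum inE andbT.
  by rewrite mem_filter => /andP[Pb _] ->; rewrite /= size_bseq.
rewrite esum_fset; [|exact: finite_seq|by move=> a _; rewrite lee_fin].
by rewrite -fsbig_seq// big_map big_filter big_enum_cond -sumEFin.
Qed.

End finite_esum.

Section integral_of_path_sums.
Context {R : realType} {q : nat} {d : measure_display} {X : measurableType d}.
Variables (m : {measure set X -> \bar R}) (e : X -> Tbar q) (M : edge q -> R).
Hypothesis e_meas : forall a, measurable (e @^-1` shadow a).
Hypothesis mM : forall a, m (e @^-1` shadow a) = (M a)%:E.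
Implicit Types (f G : edge q -> R) (N : nat).

(** A path sum up to level [N] is a finite combination of indicators of
shadows. The map [e] covers at once the whole tree and its boundary. *)
Lemma pathsum_truncE N f x : pathsum f (trunc N (e x)) =
  \sum_(a : N.-bseq (child q)) f a * \1_(e @^-1` shadow a) x.
Proof.
rewrite -(sum_prefix (N := N)) ?size_trunc//.
rewrite big_mkcond; apply: eq_bigr => a _; rewrite indicE.
have aN := size_bseq a.
case: ifPn => ap.
  by rewrite mem_set ?mulr1//; apply: trunc_geod ap.
rewrite memNset ?mulr0// => /(geod_trunc _ aN) ap'.
by rewrite ap' in ap.
Qed.

(** Any function of the truncated geodesic is a path sum, namely that of its
increments. *)
Lemma measurable_trunc N G : measurable_fun setT (fun x => G (trunc N (e x))).
Proof.
under eq_fun do rewrite -(pathsum_incr G) pathsum_truncE.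
by apply: measurable_sum => a; exact: measurable_funM.
Qed.

Local Open Scope ereal_scope.

Lemma integral_pathsum N f : (forall a, (0 <= f a)%R) ->
  \int[m]_x (pathsum f (trunc N (e x)))%:E =
  (\sum_(a : N.-bseq (child q)) f a * M a)%:E.
Proof.
move=> f0; under eq_integral do rewrite pathsum_truncE -sumEFin.
rewrite ge0_integral_sum//; last first.
- by move=> a x _; rewrite lee_fin mulr_ge0.
- move=> a; apply/measurable_EFinP; exact: measurable_funM.
rewrite -sumEFin; apply: eq_bigr => a _.
under eq_integral do rewrite EFinM.
rewrite ge0_integralZl_EFin//; last first.
- by apply/measurable_EFinP.
- by rewrite integral_indic// setIT mM.
Qed.

(** The power of a path sum is the path sum of its increments. *)
Lemma integral_path_power N f p : (0 < p)%R -> (forall a, (0 <= f a)%R) ->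
  \int[m]_x (pathsum f (trunc N (e x)) `^ p)%:E =
  (\sum_(a : N.-bseq (child q)) incr (fun t => pathsum f t `^ p)%R a * M a)%:E.
Proof.
move=> p0 f0; rewrite -integral_pathsum; last first.
  by move=> a; exact: incr_powR_ge0.
by apply: eq_integral => x _; rewrite pathsum_incr.
Qed.

Lemma esum_geod_le f x c : (forall a, (0 <= f a)%R) ->
  (forall N, (pathsum f (trunc N x) <= c)%R) ->
  \esum_(a in geod x) (f a)%:E <= c%:E.
Proof.
move=> f0 fc; apply: ge_ereal_sup => _ [A [finA Ax] <-].
rewrite fsbig_finite//= sumEFin lee_fin.
set s := finmap.enum_fset _.
pose N := (\max_(a <- s) size a)%N.
apply: le_trans (fc N); apply: sum_uniq_prefix => //.
  exact: finmap.fset_uniq.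
move=> a sa; apply/geod_trunc.
  by rewrite /N (big_rem a)//= leq_maxl.
by apply: Ax; move: sa; rewrite /s in_fset_set// inE.
Qed.

Lemma pathsum_le_esum N f x : (forall a, (0 <= f a)%R) ->
  (pathsum f (trunc N x))%:E <= \esum_(a in geod x) (f a)%:E.
Proof.
move=> f0; rewrite -(sum_prefix (N := N)) ?size_trunc//.
rewrite -(esum_bseq N (fun a => prefix a (trunc N x)))//.
by apply: subset_esum => a /andP[_]; exact: trunc_geod.
Qed.

(** Monotone convergence in the level. Only the inequality between the
full sum and the limit of its truncations is needed, and it holds because each
finite set of edges on a geodesic lies above some level. *)
Lemma integral_esum_power_le f p (B : \bar R) :
  (0 < p)%R -> (forall a, (0 <= f a)%R) ->
  (forall N, \int[m]_x (pathsum f (trunc N (e x)) `^ p)%:E <= B) ->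
  \int[m]_x (\esum_(a in geod (e x)) (f a)%:E) `^ p <= B.
Proof.
move=> p0 f0 fB.
pose g N x := (pathsum f (trunc N (e x)) `^ p)%:E.
have g0 N x : 0 <= g N x by rewrite lee_fin powR_ge0.
have gmono x : {homo g^~ x : n k / (n <= k)%N >-> n <= k}.
  move=> n k nk; rewrite lee_fin powR_monotone// ?pathsum_ge0//.
  by rewrite pathsum_prefix// prefix_trunc.
have gm N : measurable_fun setT (g N).
  apply/measurable_EFinP.
  exact: (measurable_trunc N (fun t => pathsum f t `^ p)%R).
have := @cvg_monotone_convergence _ _ _ m _ measurableT g gm
  (fun n x _ => g0 n x) (fun x _ => gmono x).
move=> cv; apply: (@le_trans _ _ (\int[m]_x limn (g^~ x))); last first.
  rewrite -(cvg_lim _ cv)//; apply: lime_le; first by apply/cvg_ex; eexists; exact: cv.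
  by apply: nearW => n; exact: fB.
apply: ge0_le_integral_nonmeasurable => x _; first exact: poweR_ge0.
have := ereal_nondecreasing_cvgn (gmono x) => /cvg_lim ->//.
set y := ereal_sup _.
have gy N : g N x <= y by apply: ereal_sup_ubound; exists N.
have y0 : 0 <= y by apply: le_trans (gy 0%N).
case: y y0 gy => [c|_ _|//]; last by rewrite leey.
rewrite lee_fin => c0 gc.
have key : \esum_(a in geod (e x)) (f a)%:E <= (c `^ p^-1)%:E.
  apply: esum_geod_le => // N.
  have := gc N; rewrite lee_fin => h.
  have H0 := pathsum_ge0 (trunc N (e x)) f0.
  rewrite -[leLHS](powRr1 H0) -(mulfV (lt0r_neq0 p0)) powRrM.
  by apply: powR_monotone; rewrite ?invr_gt0 ?powR_ge0.
apply: le_trans (gt0_ler_poweR (ltW p0) _ _ key) _.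
- by rewrite in_itv /= leey andbT esum_ge0// => a _; rewrite lee_fin.
- by rewrite in_itv /= leey lee_fin powR_ge0.
- by rewrite poweR_EFin -powRrM mulVf ?gt_eqF// powRr1.
Qed.

End integral_of_path_sums.

(** * Quotients by the mass of a shadow *)

Section quotients.
Context {R : realType}.
Local Open Scope ereal_scope.

(** Valid also for [m = 0], where the inverse is infinite and both sides say
that [I = 0]. *)
Lemma quotient_le (m C : R) (I : \bar R) : (0 <= m)%R -> (0 <= C)%R -> 0 <= I ->
  m%:E^-1 * I <= C%:E <-> I <= (C * m)%:E.
Proof.
move=> m0 C0 I0; have [->|mn0] := eqVneq m 0%R.
  rewrite inve0 mulr0; split=> [|I00]; last first.
    by rewrite (_ : I = 0) ?mule0//; apply/eqP; rewrite eq_le I00 I0.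
  have [->//|In0] := eqVneq I 0.
  by rewrite gt0_mulye// lt0e In0.
have mp : (0 < m)%R by rewrite lt0r mn0.
rewrite inver (negbTE mn0) muleC; split=> h.
  by rewrite EFinM -lee_pdivrMr.
by rewrite lee_pdivrMr// -EFinM.
Qed.

Lemma quotient_sup_lty (I : Type) (m : I -> R) (F : I -> \bar R) :
  (forall i, 0 <= m i)%R -> (forall i, 0 <= F i) -> inhabited I ->
  ereal_sup [set (m i)%:E^-1 * F i | i in [set: I]] < +oo <->
  exists2 C : R, (0 <= C)%R & forall i, F i <= (C * m i)%:E.
Proof.
move=> m0 F0 [i0]; set S := [set _ | _ in _].
have S0 : 0 <= ereal_sup S.
  apply: (@le_trans _ _ ((m i0)%:E^-1 * F i0)).
    by rewrite mule_ge0// inve_ge0 lee_fin.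
  by apply: ereal_sup_ubound; exists i0.
split=> [|[C C0 FC]].
  move: S0; case E : (ereal_sup S) => [C| |]//; rewrite lee_fin => C0 _.
  exists C => // i; apply/quotient_le => //.
  by rewrite -E; apply: ereal_sup_ubound; exists i.
apply: (@le_lt_trans _ _ C%:E); last by rewrite ltry.
by apply: ge_ereal_sup => _ [i _ <-]; apply/quotient_le.
Qed.

End quotients.

(** * Geometric decay *)

Section geometric_potential.
Context {R : realType} {q : nat} {d : measure_display} {X : measurableType d}.
Variables (m : {measure set X -> \bar R}) (e : X -> Tbar q) (M : edge q -> R).
Hypothesis e_meas : forall a, measurable (e @^-1` shadow a).
Hypothesis mM : forall a, m (e @^-1` shadow a) = (M a)%:E.
Local Open Scope ereal_scope.

Lemma integral_shadow_cst a (c : R) : (0 <= c)%R ->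
  \int[m]_x (c * \1_(e @^-1` shadow a) x)%:E = (c * M a)%:E.
Proof.
move=> c0; under eq_integral do rewrite EFinM.
rewrite ge0_integralZl_EFin//; last by apply/measurable_EFinP.
by rewrite integral_indic// setIT mM.
Qed.

(** This uses the additivity of the measure: the left-hand side is the integral
over the shadow of [b] of a geometric sum along the geodesic. *)
Lemma geometric_mass_le N (rho : R) b : (0 < rho)%R -> (rho < 1)%R ->
  (\sum_(a : N.-bseq (child q) | prefix b a) rho ^+ size a * M a <=
   rho ^+ size b / (1 - rho) * M b)%R.
Proof.
move=> rho0 rho1.
have rho10 : (0 < 1 - rho)%R by rewrite subr_gt0.
have c0 : (0 <= rho ^+ size b / (1 - rho))%R.
  by rewrite divr_ge0 ?exprn_ge0// ltW.
pose g (a : edge q) : R := (if prefix b a then rho ^+ size a else 0)%R.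
have g0 a : (0 <= g a)%R by rewrite /g; case: ifP => // _; rewrite exprn_ge0// ltW.
rewrite -lee_fin -(integral_shadow_cst b c0) big_mkcond /=.
rewrite (eq_bigr (fun a : N.-bseq (child q) => g a * M a)%R); last first.
  by move=> a _; rewrite /g; case: ifP => // _; rewrite mul0r.
rewrite -(integral_pathsum e_meas mM)//; apply: ge0_le_integral_nonmeasurable => x _.
  by rewrite lee_fin pathsum_ge0.
rewrite lee_fin indicE; apply: le_trans (pathsum_geometric _ _ rho0 rho1) _.
case: ifP => [bx|_]; last by rewrite mulr_ge0.
by rewrite mem_set ?mulr1//; exact: trunc_geod bx.
Qed.

End geometric_potential.

Section edge_sizes.
Context {R : realType} {q : nat}.
Hypothesis hq : (2 <= q)%N.
Implicit Types (a b : edge q).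

Lemma edge_size_gt0 a : 0 < edge_size a :> R.
Proof. by rewrite invr_gt0 exprn_gt0// ltr0n (leq_trans _ hq). Qed.

Lemma edge_size_powR a (z : R) :
  edge_size a `^ z = (q%:R^-1 `^ z) ^+ size a.
Proof.
have qv0 : 0 <= q%:R^-1 :> R by rewrite invr_ge0 ler0n.
rewrite /edge_size -exprVn -(powR_mulrn _ qv0).
by rewrite -(powR_mulrn _ (powR_ge0 _ _)) powRAC.
Qed.

Lemma child_ratio_lt1 (z : R) : 0 < z -> q%:R^-1 `^ z < 1 :> R.
Proof.
move=> z0; have q1 : 1 < q%:R :> R by rewrite ltr1n.
have qv0 : 0 <= q%:R^-1 :> R by rewrite invr_ge0 ler0n.
have := gt0_ltr_powR z0 (x := q%:R^-1) (y := 1); rewrite powR1; apply.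
- by rewrite nnegrE.
- by rewrite nnegrE.
- by rewrite invf_lt1 ?ltr0n ?(leq_trans _ hq).
Qed.

End edge_sizes.

(** * Wolff inequality and the Hardy inequality *)

Section hardy_equivalences.
Context {R : realType} {q : nat}.
Hypothesis hq : (2 <= q)%N.
Variables (mu : {finite_measure set (borel (Tbar q)) -> \bar R})
          (dx : {measure set (borel (boundary q)) -> \bar R}).
Hypothesis hdx : forall a : edge q, dx (bd_shadow a) = (edge_size a)%:E.
Implicit Types (a b : edge q) (p r s : R) (N : nat).

Definition mass a : R := fine (mu (shadow a)).

Lemma massE a : mu (shadow a) = (mass a)%:E.
Proof. by rewrite fineK// fin_num_measure//; exact: measurable_shadow. Qed.

Lemma mass_ge0 a : 0 <= mass a.
Proof. exact: fine_ge0. Qed.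

(** The summand of the two conditions, cut off outside the edges below [a]; its
path sums vanish off the shadow of [a], so that local energies become integrals
over the whole boundary. *)
Definition density s a b : R :=
  if prefix a b then mass b / edge_size b `^ s else 0.

Lemma density_ge0 s a b : 0 <= density s a b.
Proof. by rewrite /density; case: ifP => // _; rewrite divr_ge0 ?mass_ge0 ?powR_ge0. Qed.

Lemma geod_downclosed (x : Tbar q) a b : geod x b -> prefix a b -> geod x a.
Proof.
move=> /(geod_trunc x (leqnn _)) bx ab.
exact: trunc_geod (prefix_trans ab bx).
Qed.

(** The terms on the left are [mass c * l ^ (1 - s)], a mass times a power of a
ratio less than 1 since [s < 1]. *)
Lemma density_potential N s a b : s < 1 -> density s a b != 0 ->
  \sum_(c : N.-bseq (child q) | prefix b c) edge_size c * density s a c <=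
  (1 - q%:R^-1 `^ (1 - s))^-1 * (edge_size b * density s a b).
Proof.
move=> s1; set rho := _ `^ (1 - s) => db.
have ab : prefix a b by move: db; rewrite /density; case: ifP => //; rewrite eqxx.
have rho0 : 0 < rho by rewrite powR_gt0// invr_gt0 ltr0n (leq_trans _ hq).
have rho1 : rho < 1 by apply: child_ratio_lt1 => //; rewrite subr_gt0.
have E c : prefix b c -> edge_size c * density s a c = rho ^+ size c * mass c.
  move=> bc; rewrite /density (prefix_trans ab bc).
  have l0 := edge_size_gt0 (R := R) hq c.
  rewrite /rho -edge_size_powR powRB; last by rewrite gt_eqF// implybT.
  by rewrite powRr1 1?ltW// mulrCA mulrA [in RHS]mulrC mulrA.
rewrite (eq_bigr (fun c : N.-bseq (child q) => rho ^+ size c * mass c));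
  last by move=> c; exact: E.
rewrite E ?prefix_refl//.
apply: le_trans (geometric_mass_le measurable_shadow massE N b rho0 rho1) _.
by rewrite le_eqVlt; apply/orP; left; apply/eqP; ring.
Qed.

Local Notation path_of N x := (trunc N (End x)).
Local Notation idT := (id : borel (Tbar q) -> Tbar q).

(** Let [X] be the left-hand side and [H] the path sum. The potential
estimate bounds [X] by a multiple of the integral of [H ^ (r - 1)] times the path
maximum, and Young's inequality turns this into [X / 2] plus a multiple of the
right-hand side. *)
Lemma wolff r s : 1 < r -> s < 1 -> exists2 K : R, 0 <= K & forall N a,
  (\int[dx]_x (pathsum (density s a) (path_of N x) `^ r)%:E <=
   K%:E * \int[dx]_x (pathmax (density s a) (path_of N x) `^ r)%:E)%E.
Proof.
move=> r1 s1; set rho : R := q%:R^-1 `^ (1 - s).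
have r0 : 0 < r by apply: lt_trans r1.
have r10 : 0 < r - 1 by rewrite subr_gt0.
have rho1 : rho < 1 by apply: child_ratio_lt1 => //; rewrite subr_gt0.
pose D := (1 - rho)^-1; have D0 : 0 < D by rewrite invr_gt0 subr_gt0.
pose r' := r / (r - 1).
have rr' : r^-1 + r'^-1 = 1 by rewrite /r'; field; rewrite !gt_eqF.
pose eps := (2 * r * D)^-1.
have eps0 : 0 < eps by rewrite invr_gt0 !mulr_gt0.
have [K K0 young] := young_eps r1 rr' eps0.
(* adding 1 makes the constant positive, so that an infinite right-hand side
   stays infinite after multiplication *)
exists (2 * r * D * K + 1); first by rewrite addr_ge0// !mulr_ge0// ltW.
move=> N a; set f := density s a; have f0 : forall b, 0 <= f b by exact: density_ge0.
set I := (\int[dx]_x (pathmax _ _ `^ r)%:E)%E.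
have I0 : (0 <= I)%E by apply: integral_ge0 => x _; rewrite lee_fin powR_ge0.
rewrite (integral_path_power measurable_bd_shadow hdx)//.
set X := \sum_(b : N.-bseq _) _.
have X0 : 0 <= X.
  apply: sumr_ge0 => b _; rewrite mulr_ge0 ?incr_powR_ge0// ltW//.
  exact: edge_size_gt0.
pose Y := \sum_(b : N.-bseq (child q))
  incr (fun t => pathsum f t `^ (r - 1)) b * f b * edge_size b.
have XY : X <= r * D * Y.
  apply: power_sum_by_potential => // b; first exact/ltW/edge_size_gt0.
  exact: density_potential.
have YI : (Y%:E <= K%:E * I + eps%:E * X%:E)%E.
  pose g b := incr (fun t => pathsum f t `^ (r - 1)) b * f b.
  have g0 b : 0 <= g b by rewrite mulr_ge0// incr_powR_ge0.
  rewrite -(integral_pathsum measurable_bd_shadow hdx N g0).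
  have mH : measurable_fun setT
      (fun x : borel (boundary q) => (pathsum f (path_of N x) `^ r)%:E).
    apply/measurable_EFinP.
    exact: (measurable_trunc measurable_bd_shadow N (fun t => pathsum f t `^ r)).
  have mX : measurable_fun setT
      (fun x : borel (boundary q) => (pathmax f (path_of N x) `^ r)%:E).
    apply/measurable_EFinP.
    exact: (measurable_trunc measurable_bd_shadow N (fun t => pathmax f t `^ r)).
  rewrite /X -(integral_path_power measurable_bd_shadow hdx N r0 f0).
  rewrite -ge0_integralZl_EFin//; [|by move=> x _; rewrite lee_fin powR_ge0].
  rewrite -ge0_integralZl_EFin//; [|by move=> x _; rewrite lee_fin powR_ge0|exact: ltW].
  rewrite -ge0_integralD//; last first.
  - by apply: measurable_funeM.
  - by move=> x _; rewrite -EFinM lee_fin mulr_ge0 ?powR_ge0// ltW.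
  - by apply: measurable_funeM.
  - by move=> x _; rewrite -EFinM lee_fin mulr_ge0 ?powR_ge0.
  apply: ge0_le_integral_nonmeasurable => x _; first by rewrite lee_fin pathsum_ge0.
  rewrite -!EFinM -EFinD lee_fin.
  apply: le_trans (pathsum_incr_mul_le _ r10 f0) _; rewrite mulrC.
  apply: le_trans (young _ _ (pathmax_ge0 _ _) (powR_ge0 _ _)) _.
  by rewrite -powRrM (conjugate_subM r1 rr').
case: I I0 YI => [c| |]//.
- rewrite -!EFinM -EFinD !lee_fin => c0 YI.
  have : X <= r * D * (K * c + eps * X).
    by apply: le_trans XY _; rewrite ler_wpM2l// mulr_ge0 ?ltW.
  have -> : r * D * (K * c + eps * X) = r * D * K * c + X / 2.
    by rewrite /eps; field; rewrite !gt_eqF.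
  move=> h; rewrite mulrDl mul1r.
  have -> : 2 * r * D * K * c = 2 * (r * D * K * c) by ring.
  lra.
- by move=> _ _; rewrite gt0_muley ?leey// lte_fin ltr_wpDl// !mulr_ge0// ltW.
Qed.

(** The testing condition, on finitely many levels with a constant independent
of their number. *)
Definition carleson p s (C : R) := forall N a,
  \sum_(b : N.-bseq (child q) | prefix a b)
    mass b `^ conj_exp p * hardy_weight p s b `^ (1 - conj_exp p) <= C * mass a.

Section exponents.
Variables (p s : R).
Hypotheses (hp : 1 < p) (hs1 : s < 1).
Local Notation r := (conj_exp p).

Lemma conj_exp_conjugate : p^-1 + r^-1 = 1.
Proof.
have p0 : 0 < p by apply: lt_trans hp.
have p10 : 0 < p - 1 by rewrite subr_gt0.
by rewrite /conj_exp; field; rewrite !gt_eqF.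
Qed.

Lemma conj_exp_gt1 : 1 < r.
Proof. exact: conjugate_gt1 hp conj_exp_conjugate. Qed.

Lemma conj_exp_gt0 : 0 < r.
Proof. exact: lt_trans conj_exp_gt1. Qed.

(** This is where the exponent of the weight comes from: [pi ^ (1 - r)] is
[l ^ (1 - r * s)]. *)
Lemma testing_term a b : edge_size b * density s a b `^ r =
  if prefix a b then mass b `^ r * hardy_weight p s b `^ (1 - r) else 0.
Proof.
have l0 := edge_size_gt0 (R := R) hq b; have r1 := conj_exp_gt1.
rewrite /density; case: ifP => _; last first.
  by rewrite powR0 ?mulr0// gt_eqF// conj_exp_gt0.
rewrite /hardy_weight -powRrM divfK; last by rewrite subr_eq0 lt_eqF.
rewrite powRB; last by rewrite (gt_eqF l0) implybT.
rewrite (powRr1 (ltW l0)) powRM ?mass_ge0 ?invr_ge0 ?powR_ge0//.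
rewrite -powRN -powRrM mulNr powRN [s * r]mulrC.
by rewrite mulrCA.
Qed.

Lemma testing_sum N a :
  \sum_(b : N.-bseq (child q) | prefix a b)
    mass b `^ r * hardy_weight p s b `^ (1 - r) =
  \sum_(b : N.-bseq (child q)) density s a b `^ r * edge_size b.
Proof.
by rewrite big_mkcond; apply: eq_bigr => b _; rewrite [RHS]mulrC testing_term.
Qed.

Lemma esum_density a (x : boundary q) :
  (\esum_(b in [set b | subedge b a /\ geod (End x) b])
     (mu (shadow b) / (edge_size b `^ s)%:E) =
   \esum_(b in geod (End x)) (density s a b)%:E)%E.
Proof.
have -> : [set b | subedge b a /\ geod (End x) b] =
  [set b | prefix a b] `&` geod (End x) by [].
rewrite esum_mkcondl; apply: eq_esum => b _.
rewrite massE inver gt_eqF ?powR_gt0 ?edge_size_gt0// -EFinM /density.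
by case: ifPn => [/set_mem /= ->//|]; rewrite notin_setE /= => /negP/negbTE ->.
Qed.

Lemma esum_density_out a (x : boundary q) : ~ bd_shadow a x ->
  (\esum_(b in geod (End x)) (density s a b)%:E = 0)%E.
Proof.
move=> ax; apply: esum1 => b xb; rewrite /density.
by case: ifP => // /(geod_downclosed xb).
Qed.

Definition sum_energy a : \bar R :=
  (\int[dx]_(x in bd_shadow a)
    (\esum_(b in [set b | subedge b a /\ geod (End x) b])
      (mu (shadow b) / (edge_size b `^ s)%:E)) `^ r)%E.

Definition sup_energy a : \bar R :=
  (\int[dx]_(x in bd_shadow a)
      (ereal_sup [set mu (shadow b) / (edge_size b `^ s)%:E
        | b in [set b | subedge b a /\ geod (End x) b]]) `^ r)%E.

Lemma sum_conditionE : sum_condition mu dx p s <->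
  exists2 C, 0 <= C & forall a, (sum_energy a <= (C * mass a)%:E)%E.
Proof.
rewrite -quotient_sup_lty.
- rewrite /sum_condition (_ : [set _ | _ in _] =
    [set ((mass a)%:E^-1 * sum_energy a)%E | a in [set: edge q]])//.
  by congr image; apply/funext => a; rewrite massE.
- exact: mass_ge0.
- by move=> a; apply: integral_ge0 => x _; exact: poweR_ge0.
- exact: inhabits [::].
Qed.

Lemma sup_conditionE : sup_condition mu dx p s <->
  exists2 C, 0 <= C & forall a, (sup_energy a <= (C * mass a)%:E)%E.
Proof.
rewrite -quotient_sup_lty.
- rewrite /sup_condition (_ : [set _ | _ in _] =
    [set ((mass a)%:E^-1 * sup_energy a)%E | a in [set: edge q]])//.
  by congr image; apply/funext => a; rewrite massE.
- exact: mass_ge0.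
- by move=> a; apply: integral_ge0 => x _; exact: poweR_ge0.
- exact: inhabits [::].
Qed.

Lemma sum_energyE a :
  sum_energy a =
  (\int[dx]_x (\esum_(b in geod (End x)) (density s a b)%:E) `^ r)%E.
Proof.
rewrite /sum_energy integral_mkcond; apply: eq_integral => x _.
rewrite patchE esum_density; case: ifPn => //; rewrite notin_setE => ax.
by rewrite esum_density_out// poweR0r// gt_eqF// conj_exp_gt0.
Qed.

(** Bound the sum by the maximum through the Wolff inequality, then the
maximum by the [l^r] norm. *)
Lemma sum_condition_of_carleson C : 0 <= C -> carleson p s C ->
  sum_condition mu dx p s.
Proof.
move=> C0 carl; have [K K0 W] := wolff conj_exp_gt1 hs1.
apply/sum_conditionE; exists (K * C); first exact: mulr_ge0.
move=> a; rewrite sum_energyE.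
apply: (integral_esum_power_le measurable_bd_shadow) => [||N].
- exact: conj_exp_gt0.
- exact: density_ge0.
apply: le_trans (W N a) _; rewrite -mulrA EFinM; apply: lee_wpmul2l => //.
apply: (@le_trans _ _ (\int[dx]_x
    (pathsum (fun b => density s a b `^ r) (path_of N x))%:E)%E).
  apply: ge0_le_integral_nonmeasurable => x _; rewrite lee_fin ?powR_ge0//.
  by apply: pathmax_powR_le; [exact: conj_exp_gt0|exact: density_ge0].
rewrite (integral_pathsum measurable_bd_shadow hdx); last first.
  by move=> b; exact: powR_ge0.
by rewrite -testing_sum lee_fin; exact: carl.
Qed.

Lemma sup_condition_of_sum : sum_condition mu dx p s -> sup_condition mu dx p s.
Proof.
move=> /sum_conditionE[C C0 CM]; apply/sup_conditionE; exists C => // a.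
apply: le_trans (CM a); apply: ge0_le_integral_nonmeasurable => x ax.
  exact: poweR_ge0.
set S := [set b | _].
have m0 b : (0 <= mu (shadow b) / (edge_size b `^ s)%:E)%E.
  by rewrite mule_ge0// inve_ge0 lee_fin powR_ge0.
have le : (ereal_sup [set mu (shadow b) / (edge_size b `^ s)%:E | b in S] <=
   \esum_(b in S) (mu (shadow b) / (edge_size b `^ s)%:E))%E.
  apply: ge_ereal_sup => _ [b Sb <-]; apply: esum_ge; exists [set b].
    by split; [exact: finite_set1|move=> _ ->].
  by rewrite fsbig_set1.
apply: gt0_ler_poweR le; first exact/ltW/conj_exp_gt0.
  rewrite in_itv /= leey andbT; apply: le_trans (m0 a) _.
  by apply: ereal_sup_ubound; exists a => //; split=> //; exact: prefix_refl.
by rewrite in_itv /= leey andbT esum_ge0.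
Qed.

(** Bound the [l^r] norm by the sum, then the sum by the maximum through the
Wolff inequality. *)
Lemma carleson_of_sup_condition : sup_condition mu dx p s ->
  exists2 C, 0 <= C & carleson p s C.
Proof.
move=> /sup_conditionE[C C0 CM]; have [K K0 W] := wolff conj_exp_gt1 hs1.
exists (K * C) => [|N a]; first exact: mulr_ge0.
have dr0 b : 0 <= density s a b `^ r by exact: powR_ge0.
rewrite testing_sum -lee_fin -(integral_pathsum measurable_bd_shadow hdx N dr0).
apply: (@le_trans _ _ (\int[dx]_x
    (pathsum (density s a) (path_of N x) `^ r)%:E)%E).
  apply: ge0_le_integral_nonmeasurable => x _; rewrite lee_fin.
    by rewrite pathsum_ge0// => b; exact: powR_ge0.
  by apply: pathsum_powR_le; [exact: conj_exp_gt1|exact: density_ge0].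
apply: le_trans (W N a) _; rewrite -mulrA EFinM; apply: lee_wpmul2l => //.
apply: le_trans (CM a); rewrite /sup_energy [leRHS]integral_mkcond.
apply: ge0_le_integral_nonmeasurable => x _; first by rewrite lee_fin powR_ge0.
rewrite patchE; case: ifPn => ax.
  move: ax; rewrite inE -poweR_EFin => ax.
  set S := ereal_sup _.
  have Sge b : subedge b a -> geod (End x) b -> ((density s a b)%:E <= S)%E.
    move=> ba xb; apply: ereal_sup_ubound; exists b => //.
    by rewrite massE inver gt_eqF ?powR_gt0 ?edge_size_gt0// -EFinM /density ifT.
  have S0 : (0 <= S)%E.
    by apply: le_trans (Sge a (prefix_refl _) ax); rewrite lee_fin density_ge0.
  apply: gt0_ler_poweR; first exact/ltW/conj_exp_gt0.
  - by rewrite in_itv /= leey andbT lee_fin pathmax_ge0.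
  - by rewrite in_itv /= leey andbT.
  rewrite /pathmax; elim/big_ind: _ => [//|y z hy hz|k _].
    by rewrite maxEle; case: ifP.
  set b := take _ _; have xb : geod (End x) b by apply: trunc_geod (prefix_take _ _).
  have [ab|/negbTE nab] := boolP (prefix a b); first exact: Sge.
  by rewrite /density nab.
rewrite /pathmax big1_idem; [|exact: maxxx|move=> k _]; last first.
  rewrite /density; case: ifP => // ab.
  move: ax; rewrite notin_setE => -[].
  by apply: geod_downclosed ab; apply: trunc_geod (prefix_take _ _).
by rewrite powR0// gt_eqF// conj_exp_gt0.
Qed.

Lemma hardy_weight_gt0 a : 0 < hardy_weight p s a.
Proof. by rewrite powR_gt0// edge_size_gt0. Qed.

Lemma hardy_of_carleson C : 0 <= C -> carleson p s C ->
  hardy_inequality mu p (hardy_weight p s).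
Proof.
move=> C0 carl; have [K K0 H] := @carleson_trace R (child q) _ _ _ hp conj_exp_conjugate C0.
have p0 : 0 < p by apply: lt_trans hp.
exists K => phi phi0.
have F0 a : 0 <= phi a `^ p * hardy_weight p s a.
  by rewrite mulr_ge0 ?powR_ge0.
apply: (integral_esum_power_le (e := idT) measurable_shadow) => // N.
rewrite (integral_path_power (e := idT) measurable_shadow massE)//.
apply: (@le_trans _ _ (K%:E * (\sum_(a : N.-bseq (child q))
   phi a `^ p * hardy_weight p s a)%:E)%E).
  rewrite -EFinM lee_fin; apply: H => // a; first exact: mass_ge0.
  exact: hardy_weight_gt0.
apply: lee_wpmul2l => //.
rewrite -(esum_bseq N xpredT F0).
exact: subset_esum.
Qed.

(** For the test function [phi = M ^ (r - 1) * pi ^ (1 - r)], cut off to the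
edges below [a] of level at most [N], both the sum of [phi ^ p * pi] and the
integral of the path sum of [phi] are the testing sum [X]. Young's inequality
between that path sum and the indicator of the shadow of [a] gives
[X <= K * M a + eps * B * X]. *)
Lemma carleson_of_hardy : hardy_inequality mu p (hardy_weight p s) ->
  exists2 C, 0 <= C & carleson p s C.
Proof.
move=> [B HB].
have p0 : 0 < p by apply: lt_trans hp.
have r1 := conj_exp_gt1.
have rp : r^-1 + p^-1 = 1 by rewrite addrC conj_exp_conjugate.
pose eps := (2 * (`|B| + 1))^-1.
have eps0 : 0 < eps by rewrite invr_gt0 mulr_gt0// ltr_wpDl.
have [K K0 young] := young_eps r1 rp eps0.
exists (2 * K) => [|N a]; first by rewrite mulr_ge0.
set w := hardy_weight p s; set X := leLHS.
have w0 b : 0 < w b by exact: hardy_weight_gt0.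
pose phi b := if (size b <= N)%N && prefix a b then
   mass b `^ (r - 1) * w b `^ (1 - r) else 0.
have phi0 b : 0 <= phi b.
  by rewrite /phi; case: ifP => // _; rewrite mulr_ge0 ?powR_ge0.
have X0 : 0 <= X by apply: sumr_ge0 => b _; rewrite mulr_ge0 ?powR_ge0.
have prr : p * (r - 1) = r by rewrite mulrC (conjugate_subM r1 rp).
have phiM (b : N.-bseq (child q)) : phi b * mass b =
    if prefix a b then mass b `^ r * w b `^ (1 - r) else 0.
  rewrite /phi size_bseq /=; case: ifP => _; last by rewrite mul0r.
  by rewrite mulrC mulrA mulr_powRB1 ?mass_ge0// conj_exp_gt0.
have wp (y : R) : 0 < y -> (y `^ (1 - r)) `^ p * y = y `^ (1 - r).
  move=> y0; have e1 : 1 - r = (1 - r) * p + 1 by rewrite -[in LHS]prr; ring.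
  rewrite [in RHS]e1 [in RHS]powRD; last by rewrite (gt_eqF y0) implybT.
  by rewrite powRrM (powRr1 (ltW y0)).
have phip b : phi b `^ p * w b = if (size b <= N)%N && prefix a b then
    mass b `^ r * w b `^ (1 - r) else 0.
  rewrite /phi; case: ifP => _; last by rewrite powR0 ?gt_eqF// mul0r.
  rewrite powRM ?powR_ge0// -[in LHS]powRrM [(r - 1) * p]mulrC prr.
  by rewrite -mulrA wp.
have E1 : (\int[mu]_x (pathsum phi (trunc N x))%:E = X%:E)%E.
  rewrite (integral_pathsum (e := idT) measurable_shadow massE)//; congr (_%:E).
  by rewrite /X [RHS]big_mkcond; apply: eq_bigr => b _; exact: phiM.
have E2 : (\esum_(b in [set: edge q]) (phi b `^ p * w b)%:E = X%:E)%E.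
  rewrite /X -(esum_bseq N (fun b => prefix a b)
    (f := fun b => mass b `^ r * w b `^ (1 - r))); last first.
    by move=> b; rewrite mulr_ge0 ?powR_ge0.
  rewrite [RHS]esum_mkcond; apply: eq_esum => b _; rewrite phip.
  by case: ifPn => [h|/negP h]; [rewrite mem_set|rewrite memNset].
have E3 : (\int[mu]_x (pathsum phi (trunc N x) `^ p)%:E <= (B * X)%:E)%E.
  rewrite EFinM -E2; apply: le_trans (HB phi phi0).
  apply: ge0_le_integral_nonmeasurable => x _; first by rewrite lee_fin powR_ge0.
  rewrite -poweR_EFin; apply: gt0_ler_poweR; first exact: ltW.
  - by rewrite in_itv /= leey andbT lee_fin pathsum_ge0.
  - by rewrite in_itv /= leey andbT esum_ge0// => b _; rewrite lee_fin.
  - exact: pathsum_le_esum.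
have E4 : (X%:E <= (K * mass a)%:E + eps%:E * (B * X)%:E)%E.
  rewrite -E1 -(integral_shadow_cst (e := idT) measurable_shadow massE a K0).
  apply: (@le_trans _ _ (\int[mu]_x (K * \1_(shadow a) x)%:E +
     eps%:E * \int[mu]_x (pathsum phi (trunc N x) `^ p)%:E)%E); last first.
    by rewrite leeD2l// lee_wpmul2l// lee_fin ltW.
  have mH : measurable_fun setT
      (fun x : borel (Tbar q) => (pathsum phi (trunc N x) `^ p)%:E).
    apply/measurable_EFinP.
    exact: (measurable_trunc (e := idT) measurable_shadow N (fun t => pathsum phi t `^ p)).
  rewrite -ge0_integralZl_EFin//; [|by move=> x _; rewrite lee_fin powR_ge0|exact: ltW].
  rewrite -ge0_integralD//; last first.
  - by apply: measurable_funeM.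
  - by move=> x _; rewrite -EFinM lee_fin mulr_ge0 ?powR_ge0// ltW.
  - apply/measurable_EFinP; apply: measurable_funM => //.
    by apply: measurable_indic; exact: measurable_shadow.
  - by move=> x _; rewrite lee_fin mulr_ge0.
  apply: ge0_le_integral_nonmeasurable => x _; first by rewrite lee_fin pathsum_ge0.
  rewrite -EFinM -EFinD lee_fin indicE.
  have [ax|ax] := boolP (x \in shadow a).
    have := young 1 _ ler01 (pathsum_ge0 (trunc N x) phi0).
    by rewrite mul1r powR1 mulr1.
  rewrite pathsum_eq0 ?powR0 ?gt_eqF// ?mulr0 ?addr0 ?mulr0// => b bx.
  rewrite /phi; case: ifP => // /andP[_ ab].
  move: ax; rewrite notin_setE => -[].
  by apply: geod_downclosed ab; apply: trunc_geod bx.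
move: E4; rewrite -EFinM -EFinD lee_fin => E4.
have : eps * (B * X) <= X / 2.
  rewrite /eps invfM -mulrA [X / 2]mulrC ler_pM2l ?invr_gt0//.
  rewrite mulrC ler_pdivrMr ?ltr_wpDl// mulrC ler_wpM2l//.
  by rewrite (le_trans (ler_norm B))// lerDl.
rewrite -mulrA; lra.
Qed.

End exponents.

End hardy_equivalences.

Theorem theorem4 (R : realType) (q : nat) (hq : (2 <= q)%N)
  (p : R) (hp : 1 < p) (s : R) (hs0 : 0 < s) (hs1 : s < 1)
  (dx : {measure set (borel (boundary q)) -> \bar R})
  (hdx : forall a : edge q, dx (bd_shadow a) = (edge_size a)%:E)
  (mu : {finite_measure set (borel (Tbar q)) -> \bar R}) :
  (sum_condition mu dx p s <-> hardy_inequality mu p (hardy_weight p s)) /\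
  (sup_condition mu dx p s <-> hardy_inequality mu p (hardy_weight p s)).
Proof.
have sup_hardy : sup_condition mu dx p s ->
    hardy_inequality mu p (hardy_weight p s).
  move=> /(carleson_of_sup_condition hq hdx hp hs1)[C C0 carl].
  exact: hardy_of_carleson carl.
have hardy_sum : hardy_inequality mu p (hardy_weight p s) ->
    sum_condition mu dx p s.
  move=> /(carleson_of_hardy hq hp)[C C0 carl].
  exact: sum_condition_of_carleson carl.
have sum_sup : sum_condition mu dx p s -> sup_condition mu dx p s.
  exact: sup_condition_of_sum.
split; split.
- by move=> /sum_sup; exact: sup_hardy.
- exact: hardy_sum.
- exact: sup_hardy.
- by move=> /hardy_sum; exact: sum_sup.
Qed.
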